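(* Let $\rho$ be a positive density on the punctured product neighborhood $W$ and suppose there are constants $0<c\le C<\infty$ with $$cF_\mu(x,y,z)\le\rho(x,y,z)\le CF_\mu(x,y,z)\qquad\text{for all }(x,y,z)\in W.$$ Put $g_\rho=\rho g_0$ and $g_\mu=F_\mu g_0$, and let $d_\rho,d_\mu$ be the corresponding local path metrics on $W$, defined using curves contained in $W$. Then $$\sqrt c\,d_\mu\le d_\rho\le\sqrt C\,d_\mu.$$ Consequently, the identity map of $W$ extends to a bi-Lipschitz bijection between the metric completions of $(W,d_\mu)$ and $(W,d_\rho)$. In particular, for a prescribed Euclidean corner point, the completion fibre over it is empty for $g_\rho$ if and only if it is empty for $g_\mu$, and it is a singleton for $g_\rho$ if and only if it is a singleton for $g_\mu$.
   Context: Let $k\ge0$, let $V\subset\mathbb R^k$ be open, let $0<\varepsilon<1$, and let $U=[0,\varepsilon)^2\times V$ with coordinates $(x,y,z)$ (an adapted chart of a manifold with corners near the codimension-two corner stratum $\{x=y=0\}$), with $U^\circ=(0,\varepsilon)^2\times V$. Let $g_{\mathrm E}$ be the Euclidean metric and $g_0$ a smooth Riemannian metric on $U$ with $c_0g_{\mathrm E}\le g_0\le C_0g_{\mathrm E}$ for constants $0<c_0\le C_0<\infty$. Let $\mu$ be a finite nonzero positive Radon measure with compact support $E=\operatorname{supp}\mu\subset\mathbb R_{\ge0}^2$. Let $u:E\times U^\circ\to(0,\infty)$ be jointly measurable with $0<c_u\le u(\alpha;x,y,z)\le C_u<\infty$ for $\mu$-almost every $\alpha\in E$ and every $(x,y,z)\in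 U^\circ$, and assume that $F_\mu(x,y,z)=\int_E u(\alpha;x,y,z)x^{-\alpha_1}y^{-\alpha_2}\,d\mu(\alpha)$ is continuous and positive on $U^\circ$. $W=(0,\varepsilon')^2\times B$ with $0<\varepsilon'\le\varepsilon$ and $B$ a Euclidean ball relatively compact in $V$. A positive density on $W$ is a Borel measurable function $\rho:W\to(0,\infty)$; the $g_\rho$-length of an absolutely continuous curve $\gamma$ is $\int\sqrt{\rho(\gamma(t))}\,|\dot\gamma(t)|_{g_0}\,dt$, and the path metric is the infimum of lengths over absolutely continuous curves in $W$ joining two points. For a corner point $p\in\{x=y=0\}\times B$, the completion fibre over $p$ (for $g_\mu$ or $g_\rho$) is the set of points of the corresponding metric completion represented by Cauchy sequences in $W$ whose Euclidean limit is $p$. *)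

(* Defs.v *)
From HB Require Import structures.
From mathcomp Require Import all_boot all_order all_algebra.
From mathcomp Require Import all_classical all_reals all_analysis.

Set Implicit Arguments.
Unset Strict Implicit.
Unset Printing Implicit Defensive.

Import Order.TTheory GRing.Theory Num.Theory.
Import numFieldNormedType.Exports.

Local Open Scope classical_set_scope.
Local Open Scope ring_scope.

Section Coordinates.
Context {R : realType} {k : nat}.
Implicit Type p : 'rV[R]_(2 + k).

Definition xcoord p : R := lsubmx p 0 0.
Definition ycoord p : R := lsubmx p 0 1.
Definition zcoord p : 'rV[R]_k := rsubmx p.

Definition corner_chart (eps : R) (V : set 'rV[R]_k) : set 'rV[R]_(2 + k) :=
  [set p | [/\ 0 <= xcoord p < eps, 0 <= ycoord p < eps & V (zcoord p)]].

Definition punctured_chart (eps : R) (V : set 'rV[R]_k) :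
    set 'rV[R]_(2 + k) :=
  [set p | [/\ 0 < xcoord p < eps, 0 < ycoord p < eps & V (zcoord p)]].

Definition corner_points (B : set 'rV[R]_k) : set 'rV[R]_(2 + k) :=
  [set p | [/\ xcoord p = 0, ycoord p = 0 & B (zcoord p)]].

End Coordinates.

Section Euclidean.
Context {R : realType} {n : nat}.

(* The library norm and [ball] on row vectors are those of the sup norm; the
   two norms induce the same topology. *)
Definition euclid_norm (v : 'rV[R]_n) : R := Num.sqrt (\sum_i v 0 i ^+ 2).

Definition euclid_ball (c : 'rV[R]_n) (r : R) : set 'rV[R]_n :=
  [set z | euclid_norm (z - c) < r].

Definition relatively_compact_in (B V : set 'rV[R]_n) : Prop :=
  compact (closure B) /\ closure B `<=` V.

End Euclidean.

Section Smooth.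
Context {R : realType} {n : nat}.

Fixpoint iter_partial (s : seq 'I_n) (f : 'rV[R]_n -> R) : 'rV[R]_n -> R :=
  if s is i :: s' then fun p => 'D_('e_i) (iter_partial s' f) p else f.

Definition smooth_on_open (O : set 'rV[R]_n) (f : 'rV[R]_n -> R) : Prop :=
  forall s p, O p -> {for p, continuous (iter_partial s f)} /\
    forall i, derivable (iter_partial s f) p 'e_i.

(* Smoothness up to the boundary, for a subset [U] that need not be open:
   [f] extends smoothly to a neighbourhood of each point of [U]. *)
Definition smooth_on (U : set 'rV[R]_n) (f : 'rV[R]_n -> R) : Prop :=
  forall p, U p -> exists (O : set 'rV[R]_n) (h : 'rV[R]_n -> R),
    [/\ open O, O p, smooth_on_open O h & {in O `&` U, h =1 f}].

(* A metric is given by its Gram matrix in the coordinate basis. *)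
Definition metric_form (g : 'rV[R]_n -> 'M[R]_n) (p v : 'rV[R]_n) : R :=
  (v *m g p *m v^T) 0 0.

Definition metric_norm (g : 'rV[R]_n -> 'M[R]_n) (p v : 'rV[R]_n) : R :=
  Num.sqrt (metric_form g p v).

Definition riemannian_metric (U : set 'rV[R]_n) (g : 'rV[R]_n -> 'M[R]_n) :
    Prop :=
  [/\ forall i j, smooth_on U (fun p => g p i j),
      forall p, U p -> (g p)^T = g p &
      forall p v, U p -> v != 0 -> 0 < metric_form g p v].

End Smooth.

Definition borel (T : ptopologicalType) := g_sigma_algebraType (@open T).

Section Measure.
Context {R : realType}.
Variable mu : {finite_measure set (R * R)%type -> \bar R}.

Definition radon : Prop :=
  (forall K, compact K -> (mu K < +oo)%E) /\
  forall A, measurable A ->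
    mu A = ereal_sup [set mu K | K in [set K | compact K /\ K `<=` A]].

Definition measure_support : set (R * R) :=
  [set a | forall O, open O -> O a -> (0 < mu O)%E].

Definition weight {k : nat} (u : R * R -> 'rV[R]_(2 + k) -> R)
    (p : 'rV[R]_(2 + k)) : R :=
  \int[mu]_(a in measure_support)
    (u a p * xcoord p `^ (- a.1) * ycoord p `^ (- a.2)).

End Measure.

Section PathMetric.
Context {R : realType}.

Definition abs_continuous {V : normedModType R} (a b : R) (f : R -> V) :
    Prop :=
  forall e : R, 0 < e -> exists2 delta : R, 0 < delta &
    forall (m : nat) (l r : 'I_m -> R),
      (forall i, [/\ a <= l i, l i <= r i & r i <= b]) ->
      trivIset setT (fun i => `]l i, r i[%classic) ->
      \sum_i (r i - l i) < delta ->
      \sum_i `|f (r i) - f (l i)| < e.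

Context {n : nat}.
Variables (W : set 'rV[R]_n) (g : 'rV[R]_n -> 'M[R]_n).

(* Length for the conformal metric [rho *: g]. An absolutely continuous curve
   is differentiable almost everywhere, so the value of the derivative where
   it does not exist is irrelevant. *)
Definition curve_length (rho : 'rV[R]_n -> R) (a b : R)
    (gam : R -> 'rV[R]_n) : \bar R :=
  (\int[lebesgue_measure]_(t in `[a, b])
     (Num.sqrt (rho (gam t)) * metric_norm g (gam t) (derive1 gam t))%:E)%E.

Definition joins (p q : 'rV[R]_n) (a b : R) (gam : R -> 'rV[R]_n) :
    Prop :=
  [/\ a <= b, abs_continuous a b gam,
      forall t, a <= t <= b -> W (gam t), gam a = p & gam b = q].

Definition path_dist (rho : 'rV[R]_n -> R) (p q : 'rV[R]_n) : \bar R :=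
  ereal_inf [set L | exists a b gam,
    joins p q a b gam /\ L = curve_length rho a b gam].

End PathMetric.

(* The completion of [(W, d)] as the set of equivalence classes of Cauchy
   sequences in [W]. *)
Section Completion.
Context {R : realType} {T : ptopologicalType}.
Variables (W : set T) (d : T -> T -> \bar R).

Definition cauchy_sequence (s : nat -> T) : Prop :=
  (forall i, W (s i)) /\
  forall e : R, 0 < e -> exists N, forall i j,
    (N <= i)%N -> (N <= j)%N -> (d (s i) (s j) < e%:E)%E.

Definition cauchy_class (s : nat -> T) : set (nat -> T) :=
  [set t | cauchy_sequence t /\ d (s i) (t i) @[i --> \oo] --> 0%E].

Definition completion : set (set (nat -> T)) :=
  [set cauchy_class s | s in cauchy_sequence].

Definition completion_embed (p : T) : set (nat -> T) :=
  cauchy_class (fun=> p).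

(* [get] picks a representative; the limit does not depend on it. *)
Definition completion_dist (A B : set (nat -> T)) : \bar R :=
  limn (fun i => d (get A i) (get B i)).

(* [-->] refers to the original topology of [T], not to [d]. *)
Definition completion_fibre (p : T) : set (set (nat -> T)) :=
  [set A | completion A /\ exists2 s, A s & s i @[i --> \oo] --> p].

End Completion.

Definition is_singleton {X : Type} (A : set X) : Prop := exists x, A = [set x].

(* Main.v *)
(* On curves contained in W the speeds for the two conformal factors are
   pointwise comparable, hence so are lengths and their infima. Two distances
   bounded by multiples of each other have the same Cauchy sequences, and the
   same pairs of sequences are at distance tending to 0; so the two completions
   are literally the same set of classes, and the bijection is the identity.
   The triangle inequality, from concatenation of curves, is needed to know that
   the limits defining the distance of the completion exist. *)
Require Import Defs.
From HB Require Import structures.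
From mathcomp Require Import all_boot all_order all_algebra.
From mathcomp Require Import all_classical all_reals all_analysis.
From mathcomp Require Import measurable_realfun ring lra.

Set Implicit Arguments.
Unset Strict Implicit.
Unset Printing Implicit Defensive.

Import Order.TTheory GRing.Theory Num.Theory.
Import numFieldNormedType.Exports.

Local Open Scope classical_set_scope.
Local Open Scope ring_scope.

(** * Monotonicity and scaling of integrals of nonnegative functions *)

(* Measurability of the speed of an absolutely continuous curve is avoided: the
   integral of a nonnegative function is a supremum over simple functions below
   it, which gives the inequalities below without measurability. *)
Section NonmeasurableIntegral.
Context d (T : measurableType d) (R : realType).
Variable mu : {measure set T -> \bar R}.
Local Open Scope ereal_scope.
Implicit Types (D : set T) (f g : T -> \bar R).
Import HBNNSimple.

Lemma ge0_integral_le_nnsfun D f (M : \bar R) :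
  (forall x, D x -> 0 <= f x) ->
  (forall h : {nnsfun T >-> R}, (forall x, (h x)%:E <= (f \_ D) x) ->
    \int[mu]_x (h x)%:E <= M) ->
  \int[mu]_(x in D) f x <= M.
Proof.
move=> f0 fM; rewrite ge0_integralE//; apply: ge_ereal_sup => _ [h hf <-].
by rewrite -integralT_nnsfun; exact: fM.
Qed.

(** Extension by zero puts the two domains on the same footing: every simple function below the
    first extension is below the second, so the second supremum runs over a larger family. *)
Lemma le_integral_restrict (A B : set T) f g :
  (forall x, A x -> 0 <= f x) -> (forall x, B x -> 0 <= g x) ->
  (forall x, (f \_ A) x <= (g \_ B) x) ->
  \int[mu]_(x in A) f x <= \int[mu]_(x in B) g x.
Proof.
move=> f0 g0 fg; apply: ge0_integral_le_nnsfun => // h hf.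
rewrite integralT_nnsfun ge0_integralE//; apply: ereal_sup_ubound.
by exists h => // x; exact: le_trans (fg x).
Qed.

(** For a simple function [h] below [f], the function [k^-1 * h] lies below [g]; the constant is
    pulled out of the integral of [h], which is measurable. *)
Lemma le_integral_scale D f g (k : R) : (0 < k)%R ->
  (forall x, D x -> 0 <= f x) -> (forall x, D x -> 0 <= g x) ->
  (forall x, D x -> f x <= k%:E * g x) ->
  \int[mu]_(x in D) f x <= k%:E * \int[mu]_(x in D) g x.
Proof.
move=> k0 f0 g0 fg; apply: ge0_integral_le_nnsfun => // h hf.
rewrite -lee_pdivrMl// -ge0_integralZl//; last 3 first.
- by apply/measurable_EFinP.
- by move=> x _; rewrite lee_fin.
- by rewrite lee_fin invr_ge0 ltW.
apply: le_integral_restrict => //.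
  by move=> x _; rewrite mule_ge0 ?lee_fin// invr_ge0 ltW.
move=> x; rewrite [in leLHS]patchE in_setT lee_pdivrMl//.
apply: le_trans (hf x) _.
rewrite /patch; case: ifPn => [|_]; last by rewrite mule0.
by rewrite inE; exact: fg.
Qed.

End NonmeasurableIntegral.

(** * Translation and splitting of Lebesgue integrals on the line *)

Section NonmeasurableLebesgueIntegral.
Context (R : realType).
Local Notation mu := (@lebesgue_measure R).
Local Open Scope ereal_scope.
Import HBNNSimple.

Let shift_measurable (s : R) :
  measurable_fun setT (+%R s : measurableTypeR R -> measurableTypeR R).
Proof. exact: measurable_funD. Qed.

(** Lebesgue measure is determined by its values on half-open intervals, and a translation preserves
    their lengths. *)
Lemma lebesgue_measure_shift (s : R) (A : set R) : measurable A ->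
  pushforward mu (+%R s : _ -> measurableTypeR R) A = mu A.
Proof.
move=> mA; apply/esym/lebesgue_measure_unique => //= _ [[a b]] _ <-.
rewrite /pushforward/=.
have -> : +%R s @^-1` `]a, b]%classic = `](a - s)%R, (b - s)%R]%classic.
  by apply/seteqP; split => x /=; rewrite !in_itv/= ltrBlDl lerBrDl.
rewrite !lebesgue_measure_itv/= !lte_fin ltrD2r; case: ifP => // _.
by congr EFin; ring.
Qed.

Lemma ge0_integral_shift (f : R -> \bar R) (s : R) :
  measurable_fun setT f -> (forall x, 0 <= f x) ->
  \int[mu]_x f x = \int[mu]_x f (s + x)%R.
Proof.
move=> mf f0.
rewrite -[RHS](@ge0_integral_pushforward _ _ _ _ R _
  (shift_measurable s) mu setT f)//.
by apply: eq_measure_integral => A mA _; exact/esym/lebesgue_measure_shift.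
Qed.

(** Models a curve on [[a, c]] broken at [b]: [f] is its speed, [g1] and [g2] are the speeds of the
    pieces, the second in its own parameter [t], with [s + t] the joint one. The pointwise bounds
    are on open intervals because derivatives at the junction and the ends may disagree. *)
Lemma le_integral_split (a b c s : R) (f g1 g2 : R -> \bar R) :
  (a <= b <= c)%R ->
  (forall t, (a <= t <= c)%R -> 0 <= f t) ->
  (forall t, (a <= t <= b)%R -> 0 <= g1 t) ->
  (forall t, (b <= s + t <= c)%R -> 0 <= g2 t) ->
  (forall t, (a < t < b)%R -> f t <= g1 t) ->
  (forall t, (b < s + t < c)%R -> f (s + t)%R <= g2 t) ->
  \int[mu]_(t in `[a, c]) f t <=
  \int[mu]_(t in `[a, b]) g1 t + \int[mu]_(t in `[(b - s)%R, (c - s)%R]) g2 t.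
Proof.
move=> /andP[ab bc] f0 g10 g20 fg1 fg2.
apply: ge0_integral_le_nnsfun => [t|h hf].
  by rewrite /= in_itv/=; exact: f0.
have m1 : measurable (`]a, b[%classic : set (measurableTypeR R)).
  by exact: measurable_itv.
have m2 : measurable (`]b, c[%classic : set (measurableTypeR R)).
  by exact: measurable_itv.
(* Cutting [h] along the two open intervals loses only its values at [a], [b] and [c], a null
   set. *)
pose h1 := mul_nnsfun h (indic_nnsfun R m1).
pose h2 := mul_nnsfun h (indic_nnsfun R m2).
have mh (k : {nnsfun measurableTypeR R >-> R}):
    measurable_fun setT (EFin \o k).
  by apply/measurable_EFinP.
apply: (@le_trans _ _ (\int[mu]_x ((h1 x)%:E + (h2 x)%:E))).
  apply: ae_ge0_le_integral => //.
  - by move=> x _; rewrite lee_fin.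
  - exact: mh.
  - by move=> x _; rewrite adde_ge0// lee_fin.
  - by apply: emeasurable_funD; exact: mh.
  have N x : mu.-negligible [set x].
    by exists [set x]; split => //; exact: lebesgue_measure_set1.
  apply: (@negligibleS _ _ _ mu [set a; b; c]); last first.
    by apply: negligibleU => //; apply: negligibleU.
  move=> x /= /not_implyP[_ /negP]; rewrite -ltNge => hx.
  apply: contrapT => /not_orP[/not_orP[xa xb] xc]; move: hx; apply/negP.
  rewrite -leNgt lee_fin /= /mindic !indicE !mem_setE/= !in_itv/=.
  have h0 : (0 <= h x)%R by [].
  have := hf x; rewrite /patch mem_setE in_itv/=.
  move/eqP: xa => xa; move/eqP: xb => xb; move/eqP: xc => xc.
  (* Outside [[a, c]] the zero extension of [f] forces [h x = 0]. *)
  case: (ltgtP a x) xa => //= ax _; last first.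
    by rewrite lee_fin => hx; rewrite (le_anti (introT andP (conj hx h0)))
      !mul0r addr0.
  case: (ltgtP x b) xb => //= xb _; first by rewrite mulr1 lerDl mulr_ge0.
  case: (ltgtP x c) xc => //= xc _; first by rewrite mulr1 mulr0 add0r.
  by rewrite lee_fin => hx; rewrite (le_anti (introT andP (conj hx h0)))
      !mul0r addr0.
rewrite ge0_integralD//; last 4 first.
- by move=> x _; rewrite lee_fin.
- exact: mh.
- by move=> x _; rewrite lee_fin.
- exact: mh.
apply: leeD.
  apply: le_integral_restrict.
  - by move=> x _; rewrite lee_fin.
  - by move=> x /=; rewrite in_itv/=; exact: g10.
  move=> x; rewrite [in leLHS]patchE in_setT/= /mindic indicE
    /patch !mem_setE !in_itv/=.
  have [/andP[ax xb]|_] := boolP (a < x < b)%R; last first.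
    by rewrite mulr0; case: ifPn => // ?; exact: g10.
  rewrite (ltW ax) (ltW xb)/= mulr1.
  apply: le_trans (fg1 x _); last by rewrite ax xb.
  have := hf x; rewrite /patch mem_setE in_itv/= (ltW ax)/=.
  by rewrite (le_trans (ltW xb) bc).
(* Translation by [s] carries the second half into the parameter of [g2]. *)
rewrite (ge0_integral_shift s)//; last 2 first.
- exact: mh.
- by move=> x; rewrite lee_fin.
apply: le_integral_restrict.
- by move=> x _; rewrite lee_fin.
- by move=> x /=; rewrite in_itv/= lerBlDl lerBrDl; exact: g20.
move=> x; rewrite [in leLHS]patchE in_setT/= /mindic indicE
    /patch !mem_setE !in_itv/= lerBlDl lerBrDl.
have [/andP[bx xc]|_] := boolP (b < s + x < c)%R; last first.
  by rewrite mulr0; case: ifPn => // ?; exact: g20.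
rewrite (ltW bx) (ltW xc)/= mulr1.
apply: le_trans (fg2 x _); last by rewrite bx xc.
have := hf (s + x)%R; rewrite /patch mem_setE in_itv/= (ltW xc).
by rewrite (le_trans ab (ltW bx)).
Qed.

End NonmeasurableLebesgueIntegral.

(** * Absolute continuity of concatenated curves *)

Section AbsolutelyContinuousConcatenation.
Context {R : realType} {V : normedModType R}.

(** Each interval is clamped to the left and to the right of [b]. Clamping does not lengthen
    intervals, so each family meets the modulus of its own piece and costs less than [e / 2].
    Intervals collapsed to the point [b] are harmless, since [l i <= r i] is a weak inequality. *)
Lemma abs_continuous_cat (a b c s : R) (f g : R -> V) : a <= b <= c ->
  abs_continuous a b f -> abs_continuous (b - s) (c - s) g ->
  f b = g (b - s) ->
  abs_continuous a c (fun t => if t <= b then f t else g (t - s)).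
Proof.
move=> /andP[ab bc] acf acg fg e e0; have e20 : 0 < e / 2 by rewrite divr_gt0.
have [d1 d10 H1] := acf _ e20; have [d2 d20 H2] := acg _ e20.
exists (Num.min d1 d2); first by rewrite lt_min d10.
move=> m l r lr tI; rewrite lt_min => /andP[lrd1 lrd2].
have {}H1 : \sum_i `|f (Num.min (r i) b) - f (Num.min (l i) b)| < e / 2.
  apply: H1.
  - move=> i; have [al lri rc] := lr i.
    by split; rewrite ?le_min ?al ?ab// !ge_min ?lri lexx ?orbT.
  (* A common point of two clamped intervals satisfies [x < b], hence lies in both original
     intervals. *)
  - move=> i j _ _ [x [/=]]; rewrite !in_itv/= !gt_min !lt_min.
    move=> /andP[li /andP[ri xb]] /andP[lj /andP[rj _]]; apply: tI => //.
    exists x; split; rewrite /= in_itv/= ?ri ?rj andbT.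
      by move: li; rewrite [b < x]ltNge (ltW xb) orbF.
    by move: lj; rewrite [b < x]ltNge (ltW xb) orbF.
  - apply: le_lt_trans lrd1; apply: ler_sum => i _; have [_ lri _] := lr i.
    by rewrite /Num.min; case: (ltP (r i) b); case: (ltP (l i) b); lra.
have {}H2 : \sum_i `|g (Num.max (r i) b - s) - g (Num.max (l i) b - s)| < e / 2.
  apply: (H2 m (fun i => Num.max (l i) b - s) (fun i => Num.max (r i) b - s)).
  - move=> i; have [al lri rc] := lr i.
    by rewrite !lerD2r !ge_max rc bc; split; rewrite // !le_max ?lri lexx ?orbT.
  - move=> i j _ _ [x [/=]]; rewrite !in_itv/= !ltrBlDr !ltrBrDr.
    rewrite !gt_max !lt_max.
    move=> /andP[/andP[li xb] ri] /andP[/andP[lj _] rj]; apply: tI => //.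
    exists (x + s); split; rewrite /= in_itv/= ?li ?lj /=.
      by move: ri; rewrite [x + s < b]ltNge (ltW xb) orbF.
    by move: rj; rewrite [x + s < b]ltNge (ltW xb) orbF.
  - apply: le_lt_trans lrd2; apply: ler_sum => i _; have [_ lri _] := lr i.
    by rewrite /Num.max; case: (ltP (r i) b); case: (ltP (l i) b); lra.
rewrite [e]splitr; apply: le_lt_trans (ltrD H1 H2).
rewrite -big_split/=; apply: ler_sum => i _; have [_ lri _] := lr i.
have [rb|rb] := leP (r i) b.
  have lb := le_trans lri rb.
  by rewrite lb [Num.max (l i) b]max_r// subrr normr0 addr0 min_l.
have [lb|lb] := leP (l i) b; last by rewrite subrr normr0 add0r.
(* The interval reaches from [l i <= b] to beyond [b]: the common value [f b = g (b - s)] is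
   inserted. *)
rewrite -fg addrC -[X in X <= _](congr1 _ (subrKA (f b) _ _)).
exact: ler_normD.
Qed.

Lemma derive1_shift (f : R -> V) (s t : R) :
  derive1 (fun x => f (x - s)) t = derive1 f (t - s).
Proof. by rewrite /derive1; under eq_fun do rewrite -addrA. Qed.

End AbsolutelyContinuousConcatenation.

(** * Path distances: conformal comparison and triangle inequality *)

Section PathDistance.
Context {R : realType} {n : nat}.
Variables (W : set 'rV[R]_n) (g : 'rV[R]_n -> 'M[R]_n).
Implicit Type rho : 'rV[R]_n -> R.

Let speed_ge0 rho (gam : R -> 'rV[R]_n) (t : R) :
  (0 <= (Num.sqrt (rho (gam t)) * metric_norm g (gam t) (derive1 gam t))%:E)%E.
Proof. by rewrite lee_fin mulr_ge0 ?sqrtr_ge0. Qed.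

Lemma path_dist_ge0 rho p q : (0 <= path_dist W g rho p q)%E.
Proof.
apply: le_ereal_inf_tmp => _ [a [b [gam [_ ->]]]]; exact: integral_ge0.
Qed.

(** A conformal factor enters the speed through its square root, and joining curves stay in [W],
    where the bound is known. All [p] and [q] are covered: a point outside [W] has no joining curve,
    so both distances are [+oo]. *)
Lemma path_dist_scale rho1 rho2 (k : R) p q : 0 < k ->
  (forall x, W x -> rho1 x <= k * rho2 x) ->
  (path_dist W g rho1 p q <= (Num.sqrt k)%:E * path_dist W g rho2 p q)%E.
Proof.
move=> k0 rho12; rewrite -lee_pdivrMl ?sqrtr_gt0//.
apply: le_ereal_inf_tmp => _ [a [b [gam [jg ->]]]].
rewrite lee_pdivrMl ?sqrtr_gt0//.
apply: (@le_trans _ _ (curve_length g rho1 a b gam)).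
  by apply: ereal_inf_lbound; exists a, b, gam.
apply: le_integral_scale => //; first by rewrite sqrtr_gt0.
move=> t /=; rewrite in_itv/= => tab; have [_ _ gW _ _] := jg.
rewrite -EFinM lee_fin mulrA -(sqrtrM _ (ltW k0)).
by rewrite ler_wpM2r ?sqrtr_ge0// ler_wsqrtr// rho12//; exact: gW.
Qed.

(** The second parameter interval is translated by [b1 - a2], so that it starts where the first one
    ends. *)
Lemma joins_cat p q r (a1 b1 a2 b2 : R) gam1 gam2 :
  joins W p q a1 b1 gam1 -> joins W q r a2 b2 gam2 ->
  joins W p r a1 (b2 + (b1 - a2))
    (fun t => if t <= b1 then gam1 t else gam2 (t - (b1 - a2))).
Proof.
set s := b1 - a2.
move=> [ab1 ac1 W1 g1a g1b] [ab2 ac2 W2 g2a g2b].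
have b1s : b1 - s = a2 by rewrite /s subKr.
have b1c : b1 <= b2 + s by rewrite -lerBlDr b1s.
split.
- exact: le_trans b1c.
- apply: abs_continuous_cat; rewrite ?ab1 ?b1s ?addrK//.
  by rewrite g1b g2a.
- move=> t /andP[at_ tc]; case: leP => tb; first by apply: W1; rewrite at_.
  by apply: W2; rewrite lerBlDr tc andbT -b1s lerD2r ltW.
- by rewrite ab1.
(* The right end falls under [t <= b1] only if the second interval is a single point; then
   [q = r]. *)
- case: leP; rewrite ?addrK// => cb.
  have e : b2 + s = b1 by apply/le_anti; rewrite cb.
  by rewrite e g1b -g2a -b1s -e addrK.
Qed.

(** Derivatives are local, so the speed of the concatenation agrees with that of each piece at
    interior parameters; the junction is ignored by [le_integral_split]. *)
Lemma curve_length_cat rho (a1 b1 a2 b2 : R) gam1 gam2 :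
  a1 <= b1 -> a2 <= b2 ->
  (curve_length g rho a1 (b2 + (b1 - a2))
     (fun t => if t <= b1 then gam1 t else gam2 (t - (b1 - a2)))%R
   <= curve_length g rho a1 b1 gam1 + curve_length g rho a2 b2 gam2)%E.
Proof.
set s := b1 - a2; move=> ab1 ab2; have b1s : b1 - s = a2 by rewrite /s subKr.
have b1c : b1 <= b2 + s by rewrite -lerBlDr b1s.
set gam := (gam in curve_length _ _ _ _ gam).
(* Writing [a2] and [b2] as [b1 - s] and [b2 + s - s] exposes the translated interval. *)
rewrite /curve_length -[in leRHS]b1s -{2}(addrK s b2).
apply: (@le_integral_split R a1 b1 (b2 + s) s); first by rewrite ab1.
- by move=> t _; exact: speed_ge0.
- by move=> t _; exact: speed_ge0.
- by move=> t _; exact: speed_ge0.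
- move=> t /andP[_ tb].
  rewrite /gam (ltW tb) !derive1E (@near_eq_derive _ _ _ _ gam1)//.
  by near=> u; rewrite ifT// ltW//; near: u; exact: lt_nbhsl.
- move=> t /andP[bt _]; rewrite /gam [s + t <= b1]leNgt bt/= [s + t]addrC addrK.
  have -> : derive1 gam2 t = derive1 (fun u => gam2 (u - s)) (t + s).
    by rewrite derive1_shift addrK.
  rewrite !derive1E (@near_eq_derive _ _ _ _ (fun u => gam2 (u - s)))//.
  by near=> u; rewrite ifF// lt_geF//; near: u; apply: lt_nbhsr; rewrite addrC.
Unshelve. all: by end_near. Qed.

Lemma path_dist_adherent rho p q e : 0 < e ->
  path_dist W g rho p q \is a fin_num ->
  exists a b gam, joins W p q a b gam /\
    (curve_length g rho a b gam < path_dist W g rho p q + e%:E)%E.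
Proof.
move=> e0 /(lb_ereal_inf_adherent e0)[_ [a [b [gam [j ->]]]] L].
by exists a, b, gam.
Qed.

(** Two curves within [e / 2] of optimal are concatenated. Infinite distances are treated first,
    since near-optimal curves require a finite infimum. *)
Lemma path_dist_triangle rho p q r :
  (path_dist W g rho p r <= path_dist W g rho p q + path_dist W g rho q r)%E.
Proof.
have := path_dist_ge0 rho p q; have := path_dist_ge0 rho q r.
have [->|qr_fin] := eqVneq (path_dist W g rho q r) +oo%E.
  by move=> _ pq; rewrite addey ?leey// gt_eqF// (lt_le_trans _ pq).
have [->|pq_fin] := eqVneq (path_dist W g rho p q) +oo%E.
  by move=> qr _; rewrite addye ?leey// gt_eqF// (lt_le_trans _ qr).
move=> qr0 pq0; apply/lee_addgt0Pr => e e0.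
have e20 : 0 < e / 2 by rewrite divr_gt0.
have [||a1 [b1 [gam1 [j1 L1]]]] := @path_dist_adherent rho p q (e / 2) => //.
  by rewrite ge0_fin_numE// ltey.
have [||a2 [b2 [gam2 [j2 L2]]]] := @path_dist_adherent rho q r (e / 2) => //.
  by rewrite ge0_fin_numE// ltey.
have [ab1 _ _ _ _] := j1; have [ab2 _ _ _ _] := j2.
apply: ge_ereal_inf; eexists.
  by do 3 eexists; split; [exact: joins_cat j1 j2|].
apply: le_trans (curve_length_cat _ _ _ ab1 ab2) _.
apply: le_trans (leeD (ltW L1) (ltW L2)) _.
by rewrite addeACA -EFinD -splitr.
Qed.

End PathDistance.

(** * Completions under comparable distances *)

Section CompletionComparison.
Context {R : realType} {T : ptopologicalType}.
Variable W : set T.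
Implicit Types (d : T -> T -> \bar R) (s t : nat -> T).
Local Open Scope ereal_scope.

(* Symmetry of [d] is not needed: a Cauchy sequence controls both
   [d (s i) (s j)] and [d (s j) (s i)]. *)
Lemma cauchy_dist_close d s t : (forall x y, 0 <= d x y) ->
  (forall x y z, d x z <= d x y + d y z) ->
  cauchy_sequence W d s -> cauchy_sequence W d t ->
  forall e : R, (0 < e)%R -> exists N, forall i j, (N <= i)%N -> (N <= j)%N ->
    d (s i) (t i) <= d (s j) (t j) + e%:E.
Proof.
move=> d0 dT [_ cs] [_ ct] e e0; have e20 : (0 < e / 2)%R by rewrite divr_gt0.
have [N1 H1] := cs _ e20; have [N2 H2] := ct _ e20.
exists (maxn N1 N2) => i j; rewrite !geq_max => /andP[i1 i2] /andP[j1 j2].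
apply: le_trans (dT _ (s j) _) _.
rewrite [X in _ + X%:E]splitr EFinD addeA [leRHS]addeAC [leRHS]addeC addeA.
apply: le_trans (leeD2l _ (dT _ (t j) _)) _; rewrite addeA.
apply: leeD; last exact: ltW (H2 _ _ _ _).
by apply: leeD => //; exact: ltW (H1 _ _ _ _).
Qed.

Lemma is_cvg_cauchy_dist d s t : (forall x y, 0 <= d x y) ->
  (forall x y z, d x z <= d x y + d y z) ->
  cauchy_sequence W d s -> cauchy_sequence W d t ->
  cvgn (fun i => d (s i) (t i)).
Proof.
move=> d0 dT cs ct; have close := cauchy_dist_close d0 dT cs ct.
set f := fun i => d (s i) (t i).
have f0 i : 0 <= f i by exact: d0.
(* From [N] on, values differ by at most [1], so they are all infinite or all finite, as decided by
   [f N]. *)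
have [N HN] := close 1%R ltr01.
have [fN|fN] := eqVneq (f N) +oo.
  apply/cvg_ex; exists +oo; apply: cvg_near_cst; exists N => // i /= Ni.
  have := HN N i (leqnn _) Ni; rewrite -/(f N) fN leye_eq -/(f i).
  by case: (f i).
have ffin i : (N <= i)%N -> f i \is a fin_num.
  move=> Ni; rewrite ge0_fin_numE//; apply: le_lt_trans (HN i N Ni (leqnn _)) _.
  by rewrite -/(f N) lte_add_pinfty ?ltry// ltey.
have /cauchy_cvg/cvg_ex[l fl] : cauchy ((fine \o f) @ \oo).
  apply: cauchy_exP => e e0; have e20 : (0 < e / 2)%R by rewrite divr_gt0.
  (* Past [K] the values are finite and within [e / 2] of [f K]; halving gives the strict inequality
     of the ball. *)
  have [M HM] := close _ e20; pose K := maxn N M.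
  exists (fine (f K)); exists K => // i /=; rewrite geq_max => /andP[Ni Mi].
  have := HM i K Mi (leq_maxr _ _); have := HM K i (leq_maxr _ _) Mi.
  rewrite -/(f i) -/(f K) -(fineK (ffin _ Ni)) -(fineK (ffin _ (leq_maxl N M))).
  rewrite -!EFinD !lee_fin /ball/= => h1 h2; rewrite ltr_norml; lra.
apply/cvg_ex; exists l%:E; apply/fine_cvgP; split => //.
by exists N => // i; exact: ffin.
Qed.

Lemma cauchy_sequence_le d1 d2 (k : R) s : (0 < k)%R ->
  (forall x y, d1 x y <= k%:E * d2 x y) ->
  cauchy_sequence W d2 s -> cauchy_sequence W d1 s.
Proof.
move=> k0 d12 [sW cs]; split=> // e e0.
have [|N H] := cs (k^-1 * e)%R; first by rewrite mulr_gt0 ?invr_gt0.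
exists N => i j Ni Nj; apply: le_lt_trans (d12 _ _) _.
by rewrite -lte_pdivlMl//; exact: H.
Qed.

Lemma cauchy_class_le d1 d2 (k : R) s : (0 < k)%R ->
  (forall x y, 0 <= d1 x y) -> (forall x y, d1 x y <= k%:E * d2 x y) ->
  cauchy_class W d2 s `<=` cauchy_class W d1 s.
Proof.
move=> k0 d10 d12 t [ct st]; split; first exact: cauchy_sequence_le k0 d12 ct.
apply: (@squeeze_cvge _ _ _ _ (cst 0) _ (fun i => k%:E * d2 (s i) (t i))).
- by near=> i; rewrite d10 d12.
- exact: cvg_cst.
- by rewrite -(mule0 k%:E); apply: cvgeZl.
Unshelve. all: by end_near. Qed.

(** The Cauchy condition at equal indices makes [d (s i) (s i)] tend to 0. *)
Lemma cauchy_class_refl d s : (forall x y, 0 <= d x y) ->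
  cauchy_sequence W d s -> cauchy_class W d s s.
Proof.
move=> d0 cs; split=> //; apply/fine_cvgP; split.
  have [N H] := cs.2 1%R ltr01; exists N => // i Ni.
  by rewrite ge0_fin_numE//; apply: lt_le_trans (H _ _ Ni Ni) _; rewrite leey.
apply/cvgrPdist_lt => e e0; have [N H] := cs.2 _ e0; exists N => // i Ni.
have := H i i Ni Ni; have := d0 (s i) (s i); rewrite /= sub0r normrN.
case: (d (s i) (s i)) => // x; rewrite lee_fin lte_fin /= => x0.
by rewrite ger0_norm.
Qed.

(** A class contains the sequence that defines it, so [get] returns a genuine member and not a
    default value. *)
Lemma completion_get d A : (forall x y, 0 <= d x y) -> completion W d A ->
  cauchy_sequence W d (get A).
Proof.
move=> d0 [s cs <-].
suff [] : cauchy_class W d s (get (cauchy_class W d s)) by [].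
by apply: getPex; exists s; exact: cauchy_class_refl.
Qed.

Section Equivalent.
Variables (d1 d2 : T -> T -> \bar R) (k1 k2 : R).
Hypotheses (k1_gt0 : (0 < k1)%R) (k2_gt0 : (0 < k2)%R).
Hypotheses (d1_ge0 : forall x y, 0 <= d1 x y).
Hypotheses (d2_ge0 : forall x y, 0 <= d2 x y).
Hypotheses (d12 : forall x y, d1 x y <= k1%:E * d2 x y).
Hypotheses (d21 : forall x y, d2 x y <= k2%:E * d1 x y).

Lemma cauchy_class_equiv : cauchy_class W d1 = cauchy_class W d2.
Proof.
by apply/funext => s; apply/seteqP; split;
  [exact: cauchy_class_le k2_gt0 d2_ge0 d21|
   exact: cauchy_class_le k1_gt0 d1_ge0 d12].
Qed.

Lemma completion_equiv : completion W d1 = completion W d2.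
Proof.
rewrite /completion cauchy_class_equiv; congr image; apply/seteqP.
by split => s; [exact: cauchy_sequence_le k2_gt0 d21|
  exact: cauchy_sequence_le k1_gt0 d12].
Qed.

Lemma completion_fibre_equiv p :
  completion_fibre W d1 p = completion_fibre W d2 p.
Proof. by rewrite /completion_fibre completion_equiv. Qed.

Hypotheses (d1_triangle : forall x y z, d1 x z <= d1 x y + d1 y z).
Hypotheses (d2_triangle : forall x y z, d2 x z <= d2 x y + d2 y z).

(** Both completion distances are limits along the same representatives [get A] and [get B], so the
    pointwise bound passes to the limit. *)
Lemma completion_dist_le A B : completion W d1 A -> completion W d1 B ->
  completion_dist d1 A B <= k1%:E * completion_dist d2 A B.
Proof.
move=> cA cB; have c1A := completion_get d1_ge0 cA.
have c1B := completion_get d1_ge0 cB.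
have c2 : cvgn (fun i => d2 (get A i) (get B i)).
  by apply: is_cvg_cauchy_dist => //; exact: cauchy_sequence_le k2_gt0 d21 _.
rewrite /completion_dist; apply: (@le_trans _ _
    (limn (fun i => k1%:E * d2 (get A i) (get B i)))).
  apply: lee_lim; first exact: is_cvg_cauchy_dist.
    exact: is_cvgeZl.
  by near=> i.
by rewrite (cvg_lim _ (cvgeZl _ c2)).
Unshelve. all: by end_near. Qed.

End Equivalent.

Lemma bilipschitz_completion d1 d2 (k1 k2 : R) : (0 < k1)%R -> (0 < k2)%R ->
  (forall x y, 0 <= d1 x y) -> (forall x y, 0 <= d2 x y) ->
  (forall x y, d1 x y <= k1%:E * d2 x y) ->
  (forall x y, d2 x y <= k2%:E * d1 x y) ->
  (forall x y z, d1 x z <= d1 x y + d1 y z) ->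
  (forall x y z, d2 x z <= d2 x y + d2 y z) ->
  exists Phi : set (nat -> T) -> set (nat -> T),
    [/\ set_bij (completion W d1) (completion W d2) Phi,
        forall p, W p ->
          Phi (completion_embed W d1 p) = completion_embed W d2 p &
        exists2 L : R, (0 < L)%R & forall A B,
          completion W d1 A -> completion W d1 B ->
          completion_dist d1 A B <= L%:E * completion_dist d2 (Phi A) (Phi B) /\
          completion_dist d2 (Phi A) (Phi B) <= L%:E * completion_dist d1 A B].
Proof.
move=> k10 k20 d10 d20 d12 d21 d1T d2T.
(* The sum dominates both constants and serves in both directions. *)
pose L := (k1 + k2)%R; have L0 : (0 < L)%R by rewrite addr_gt0.
have {}d12 x y : d1 x y <= L%:E * d2 x y.
  by apply: le_trans (d12 x y) _; rewrite lee_wpmul2r// lee_fin lerDl ltW.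
have {}d21 x y : d2 x y <= L%:E * d1 x y.
  by apply: le_trans (d21 x y) _; rewrite lee_wpmul2r// lee_fin lerDr ltW.
have c12 := completion_equiv L0 L0 d10 d20 d12 d21.
exists id; split.
- by rewrite c12; split => // A cA; exists A.
- by move=> p _; rewrite /completion_embed
    (cauchy_class_equiv L0 L0 d10 d20 d12 d21).
- exists L => // A B cA cB; split.
    exact: (completion_dist_le L0 d10 d20 d12 d21).
  by apply: (completion_dist_le L0 d20 d10 d21 d12); rewrite -?c12.
Qed.

End CompletionComparison.

(** * Comparison of the metrics with factors [rho] and [weight mu u] *)

Theorem proposition12p2 (R : realType) (k : nat)
  (V : set 'rV[R]_k) (V_open : open V)
  (eps : R) (eps_gt0 : 0 < eps) (eps_lt1 : eps < 1)
  (g0 : 'rV[R]_(2 + k) -> 'M[R]_(2 + k))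
  (g0_riem : riemannian_metric (corner_chart eps V) g0)
  (c0 C0 : R) (c0_gt0 : 0 < c0) (c0_le_C0 : c0 <= C0)
  (g0_bnd : forall p v, corner_chart eps V p ->
     c0 * euclid_norm v ^+ 2 <= metric_form g0 p v <= C0 * euclid_norm v ^+ 2)
  (mu : {finite_measure set (R * R)%type -> \bar R})
  (mu_radon : radon mu) (mu_neq0 : (0 < mu setT)%E)
  (supp_compact : compact (measure_support mu))
  (supp_ge0 : measure_support mu `<=` [set a | 0 <= a.1 /\ 0 <= a.2])
  (u : R * R -> 'rV[R]_(2 + k) -> R)
  (u_gt0 : forall a p, measure_support mu a -> punctured_chart eps V p ->
     0 < u a p)
  (u_meas : measurable_fun
     (measure_support mu `*` punctured_chart eps V
        : set ((R * R) * borel 'rV[R]_(2 + k)))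
     (fun w : (R * R) * borel 'rV[R]_(2 + k) => u w.1 w.2))
  (cu Cu : R) (cu_gt0 : 0 < cu) (cu_le_Cu : cu <= Cu)
  (u_bnd : {ae mu, forall a, measure_support mu a ->
     forall p, punctured_chart eps V p -> cu <= u a p <= Cu})
  (F_cont : {within punctured_chart eps V, continuous (weight mu u)})
  (F_gt0 : forall p, punctured_chart eps V p -> 0 < weight mu u p)
  (eps' : R) (eps'_gt0 : 0 < eps') (eps'_le : eps' <= eps)
  (z0 : 'rV[R]_k) (r : R) (r_gt0 : 0 < r)
  (B_rc : relatively_compact_in (euclid_ball z0 r) V)
  (rho : 'rV[R]_(2 + k) -> R)
  (rho_gt0 : forall p, punctured_chart eps' (euclid_ball z0 r) p -> 0 < rho p)
  (rho_meas : measurable_fun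
     (punctured_chart eps' (euclid_ball z0 r) : set (borel 'rV[R]_(2 + k)))
     (rho : borel 'rV[R]_(2 + k) -> R))
  (c C : R) (c_gt0 : 0 < c) (c_le_C : c <= C)
  (rho_bnd : forall p, punctured_chart eps' (euclid_ball z0 r) p ->
     c * weight mu u p <= rho p <= C * weight mu u p) :
  let W := punctured_chart eps' (euclid_ball z0 r) in
  let d_rho := path_dist W g0 rho in
  let d_mu := path_dist W g0 (weight mu u) in
  [/\ forall p q, W p -> W q ->
        ((Num.sqrt c)%:E * d_mu p q <= d_rho p q)%E /\
        (d_rho p q <= (Num.sqrt C)%:E * d_mu p q)%E,
      exists Phi : set (nat -> 'rV[R]_(2 + k)) -> set (nat -> 'rV[R]_(2 + k)),
        [/\ set_bij (completion W d_mu) (completion W d_rho) Phi,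
            forall p, W p ->
              Phi (completion_embed W d_mu p) = completion_embed W d_rho p &
            exists2 L : R, 0 < L &
              forall A B, completion W d_mu A -> completion W d_mu B ->
                (completion_dist d_mu A B
                   <= L%:E * completion_dist d_rho (Phi A) (Phi B))%E /\
                (completion_dist d_rho (Phi A) (Phi B)
                   <= L%:E * completion_dist d_mu A B)%E] &
      forall p, corner_points (euclid_ball z0 r) p ->
        (completion_fibre W d_rho p = set0 <->
           completion_fibre W d_mu p = set0) /\
        (is_singleton (completion_fibre W d_rho p) <->
           is_singleton (completion_fibre W d_mu p))].
Proof.
move=> W d_rho d_mu; have C_gt0 : 0 < C by exact: lt_le_trans c_le_C.
have rho_mu p q : (d_rho p q <= (Num.sqrt C)%:E * d_mu p q)%E.
  by apply: path_dist_scale => // x Wx; have /andP[] := rho_bnd x Wx.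
(* The lower bound on [rho], read as [weight mu u <= c^-1 * rho], reverses the roles. *)
have mu_rho p q : (d_mu p q <= (Num.sqrt c^-1)%:E * d_rho p q)%E.
  apply: path_dist_scale => [|x Wx]; first by rewrite invr_gt0.
  by rewrite ler_pdivlMl//; have /andP[] := rho_bnd x Wx.
have C'_gt0 : 0 < Num.sqrt C by rewrite sqrtr_gt0.
have c'_gt0 : 0 < Num.sqrt c^-1 by rewrite sqrtr_gt0 invr_gt0.
have rho0 p q : (0 <= d_rho p q)%E by exact: path_dist_ge0.
have mu0 p q : (0 <= d_mu p q)%E by exact: path_dist_ge0.
have rhoT : forall x y z, (d_rho x z <= d_rho x y + d_rho y z)%E.
  by move=> x y z; exact: path_dist_triangle.
have muT : forall x y z, (d_mu x z <= d_mu x y + d_mu y z)%E.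
  by move=> x y z; exact: path_dist_triangle.
split.
- move=> p q _ _; split; last exact: rho_mu.
  by rewrite -lee_pdivlMl ?sqrtr_gt0// -sqrtrV; [exact: mu_rho|exact: ltW].
- exact: (bilipschitz_completion W c'_gt0 C'_gt0 mu0 rho0 mu_rho rho_mu
    muT rhoT).
- move=> p _.
  (* The two fibres are the same set of classes, so both equivalences become reflexive. *)
  by rewrite (completion_fibre_equiv W c'_gt0 C'_gt0 mu0 rho0 mu_rho rho_mu).
Qed.
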